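(* Let $p,q\in(1,\infty)$. Then: (1) the function $x\mapsto\sin_{p,q}(x)$ is geometrically concave on $(0,1)$; (2) the function $x\mapsto\sinh_{p,q}(x)$ is geometrically convex on $(0,1)$.
   Context: For $p,q>1$ define $\arcsin_{p,q}(x)=\int_0^x(1-t^q)^{-1/p}\,dt$ for $x\in[0,1]$ and $\frac{\pi_{p,q}}{2}=\int_0^1(1-t^q)^{-1/p}\,dt$. Then $\arcsin_{p,q}:[0,1]\to[0,\frac{\pi_{p,q}}{2}]$ is an increasing homeomorphism, and $\sin_{p,q}:[0,\frac{\pi_{p,q}}{2}]\to[0,1]$ denotes its inverse. Define also $\operatorname{arcsinh}_{p,q}(x)=\int_0^x(1+t^q)^{-1/p}\,dt$ for $x\in(0,\infty)$ and $m^*_{p,q}=\int_0^\infty(1+t^q)^{-1/p}\,dt\in(0,\infty]$. The function $\sinh_{p,q}:(0,m^*_{p,q})\to(0,\infty)$ denotes the inverse of $\operatorname{arcsinh}_{p,q}$. Both domains $(0,\frac{\pi_{p,q}}{2})$ and $(0,m^*_{p,q})$ contain $(0,1)$. Let $I\subseteq(0,\infty)$ be an interval and $f:I\to(0,\infty)$ a continuous function. $f$ is geometrically convex on $I$ if $f(x^\lambda y^{1-\lambda})\le f(x)^\lambda f(y)^{1-\lambda}$ for all $x,y\in I$ and $\lambda\in[0,1]$; it is geometrically concave on $I$ if the reversed inequality holds for all $x,y\in I$ and $\lambda\in[0,1]$. *)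

(* Defs.v *)
From HB Require Import structures.
From mathcomp Require Import all_boot all_order all_algebra.
From mathcomp Require Import all_classical all_reals all_analysis.
Set Implicit Arguments.
Unset Strict Implicit.
Unset Printing Implicit Defensive.
Import Order.TTheory GRing.Theory Num.Theory.
Import numFieldNormedType.Exports.
Local Open Scope classical_set_scope.
Local Open Scope ring_scope.

Section generalized_functions.
Context {R : realType}.
Implicit Types (p q x : R).

(* The integrand is unbounded at t = 1; as a Lebesgue integral, [arcsin_pq p q 1]
   is nevertheless the improper integral pi_{p,q}/2. *)
Definition arcsin_pq p q x : R :=
  \int[@lebesgue_measure R]_(t in `[0, x]) (1 - t `^ q) `^ (- p^-1).

Definition arcsinh_pq p q x : R :=
  \int[@lebesgue_measure R]_(t in `[0, x]) (1 + t `^ q) `^ (- p^-1).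

(* The inverses live on the images [0, pi_{p,q}/2] = arcsin_pq @` [0, 1] and
   (0, m*_{p,q}) = arcsinh_pq @` (0, +oo).  Outside these images they take the
   junk value 0, which the positivity clause of the definitions of geometric
   convexity and concavity rules out. *)
Definition sin_pq p q : R -> R := 'pinv_(fun=> 0) `[0, 1] (arcsin_pq p q).

Definition sinh_pq p q : R -> R := 'pinv_(fun=> 0) `]0, +oo[ (arcsinh_pq p q).

End generalized_functions.

Section geometric_convexity.
Context {R : realType}.
Implicit Types (I : set R) (f : R -> R).

(* f restricts to a continuous function from I to (0, +oo), with I an interval
   contained in (0, +oo). *)
Definition continuous_positive_on I f :=
  [/\ is_interval I, I `<=` `]0, +oo[, {within I, continuous f}
    & forall x, I x -> 0 < f x].

Definition geometrically_convex I f :=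
  continuous_positive_on I f /\
  forall x y l, I x -> I y -> 0 <= l <= 1 ->
    f (x `^ l * y `^ (1 - l)) <= f x `^ l * f y `^ (1 - l).

Definition geometrically_concave I f :=
  continuous_positive_on I f /\
  forall x y l, I x -> I y -> 0 <= l <= 1 ->
    f x `^ l * f y `^ (1 - l) <= f (x `^ l * y `^ (1 - l)).

End geometric_convexity.

(* Main.v *)
Require Import Defs.
From mathcomp Require Import all_boot all_order all_algebra.
From mathcomp Require Import all_classical all_reals all_analysis.
From mathcomp Require Import measurable_realfun ring lra.
Import Order.TTheory GRing.Theory Num.Theory.
Import numFieldNormedType.Exports.
Local Open Scope classical_set_scope.
Local Open Scope ring_scope.

(** A positive function [F] on an interval of positive reals is geometrically
convex (concave) when [u |-> ln (F (exp u))] is convex (concave), that is, when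
its elasticity [k x = x * F'(x) / F x] is nondecreasing (nonincreasing).  Both
[arcsin_{p,q}] and [arcsinh_{p,q}] are of the form [F x = \int_0^x f] with
[f t = (1 + c * t ^ q) ^ (- 1 / p)], where [c = -1] or [c = 1].  The elasticity
of the integrand is
  [e t = t * f'(t) / f t = - (q / p) * c * t ^ q / (1 + c * t ^ q)],
and [c * e] is nonincreasing whatever the sign of [c].

Monotonicity passes from [e] to [k].  Indeed [(t * f t)' = (1 + e t) * f t],
so, for fixed [y], [t * f t - (1 + e y) * F t] vanishes at [0] and has the
derivative [(e t - e y) * f t], whose sign on [[0, y]] is that of [c]; this
gives the sign of [y * f y - (1 + e y) * F y] ([integrand_elasticity_bound]),
and the derivative of [k] at [y] is a negative multiple of this expression
([elasticity_monotone]).  Hence [F] lies on one side of each power function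
[t |-> F x * (t / x) ^ k x] tangent to it ([power_bound]), and multiplying two
such bounds taken at the geometric mean gives
  [c * (F x ^ l * F y ^ (1 - l)) <= c * F (x ^ l * y ^ (1 - l))]
([primitive_geometric]): [arcsin_{p,q}] is geometrically convex, and
[arcsinh_{p,q}] geometrically concave.  As [F] is increasing, the reversed
inequalities hold for the inverse function ([inverse_geometric]).

It remains to see that the inverse functions are defined on [(0, 1)].  This
follows from explicit lower bounds and the intermediate value theorem:
[arcsin_{p,q} x >= x], and
[arcsinh_{p,q} x >= x * (1 + x ^ q) ^ (- 1 / q)], whose right-hand side
takes every value in [(0, 1)]. *)

(** * Monotonicity from the sign of the derivative, and weighted means *)

Lemma le_of_derive_ge0 (R : realType) (h dh : R -> R) (u v : R) : u <= v ->
  {within `[u, v], continuous h} ->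
  (forall t : R, u < t < v -> is_derive t 1 h (dh t)) ->
  (forall t : R, u < t < v -> 0 <= dh t) ->
  h u <= h v.
Proof.
move=> uv ch dhE dh0; move: (uv); rewrite le_eqVlt => /predU1P[->//|uv'].
have dhE' t : t \in `]u, v[ -> is_derive t 1 h (dh t).
  by rewrite in_itv => /dhE.
have [c cuv hE] := MVT uv' dhE' ch.
by rewrite -subr_ge0 hE mulr_ge0 ?subr_ge0// dh0// -in_itv.
Qed.

Lemma powR_mean (R : realType) (a l : R) : 0 <= a -> a `^ l * a `^ (1 - l) = a.
Proof.
move=> a0; rewrite -powRD addrC subrK ?powRr1//.
by rewrite oner_eq0.
Qed.

Lemma powR_lt1 (R : realType) (x q : R) : 0 < q -> 0 <= x ->
  (x `^ q < 1) = (x < 1).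
Proof.
move=> q0 x0; have p1 : 1 `^ q = 1 :> R by rewrite powR1.
have [x1|x1] := ltP x 1.
  by rewrite -[ltRHS]p1 gt0_ltr_powR// ?nnegrE ?ler01.
by apply/negbTE; rewrite -leNgt -[leLHS]p1 ge0_ler_powR// ?nnegrE ltW.
Qed.

(** * Primitives of functions with monotone elasticity *)

(** The scalar [s], of which only the sign matters, treats increasing and
decreasing elasticities [e] of [f] at once. *)
Section elasticity.
Context {R : realType}.
Variables (s b : R) (F f e : R -> R).
Hypothesis cF : {within `[0, b], continuous F}.
Hypothesis F0 : F 0 = 0.
Hypothesis dF : forall t : R, 0 < t <= b -> is_derive t 1 F (f t).
Hypothesis cf : {within `[0, b], continuous f}.
Hypothesis f_gt0 : forall t : R, 0 < t <= b -> 0 < f t.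
Hypothesis df : forall t : R, 0 < t <= b -> is_derive t 1 f (e t / t * f t).
Hypothesis e_mono :
  forall t u : R, 0 < t -> t <= u -> u <= b -> s * e u <= s * e t.

Lemma within_continuous_subitv (g : R -> R) u v : 0 <= u -> v <= b ->
  {within `[0, b], continuous g} -> {within `[u, v], continuous g}.
Proof.
move=> u0 vb; apply: continuous_subspaceW => t /=; rewrite !in_itv/=.
by case/andP=> ut tv; rewrite (le_trans u0 ut) (le_trans tv vb).
Qed.

Lemma primitive_lt u v : 0 <= u -> u < v -> v <= b -> F u < F v.
Proof.
move=> u0 uv vb.
have tb t : t \in `]u, v[ -> 0 < t <= b.
  rewrite in_itv/= => /andP[ut tv].
  by rewrite (le_lt_trans u0 ut) (le_trans (ltW tv)).
have cFuv := within_continuous_subitv _ _ _ u0 vb cF.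
have [|c cuv hE] := @MVT R F f u v uv _ cFuv.
  by move=> t /tb; exact: dF.
by rewrite -subr_gt0 hE mulr_gt0 ?subr_gt0 ?f_gt0 ?tb.
Qed.

Lemma primitive_gt0 t : 0 < t <= b -> 0 < F t.
Proof. by case/andP=> t0 tb; rewrite -F0 primitive_lt. Qed.

(** This is a monotone form of l'Hospital's rule: [(1 + e t) * f t] is the
derivative of [t * f t], so [y * f y] is the integral of [(1 + e) * f] over
[[0, y]], where the factor [1 + e t] compares with its last value [1 + e y]. *)
Lemma integrand_elasticity_bound y : 0 < y <= b ->
  0 <= s * (y * f y - (1 + e y) * F y).
Proof.
case/andP=> y0 yb.
pose h t := s * (t * f t - (1 + e y) * F t).
have h0 : h 0 = 0 by rewrite /h F0; ring.
rewrite -[X in X <= _]h0 -/(h y).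
apply: (@le_of_derive_ge0 _ _ (fun t => s * (e t - e y) * f t)).
- exact: ltW.
- have cfy := within_continuous_subitv _ _ _ (lexx 0) yb cf.
  have cFy := within_continuous_subitv _ _ _ (lexx 0) yb cF.
  move=> t; apply: cvgM; first exact: cvg_cst.
  apply: cvgB; apply: cvgM; [|exact: cfy|exact: cvg_cst|exact: cFy].
  exact: (continuous_subspaceT (fun x => cvg_id)).
- move=> t /andP[t0 ty].
  have tb : 0 < t <= b by rewrite t0 (le_trans (ltW ty)).
  have := dF _ tb; have := df _ tb => dft dFt.
  have -> : h = cst s * (id * f - cst (1 + e y) * F) by [].
  apply: is_derive_eq.
  rewrite /= /GRing.scale/=; field.
  by rewrite gt_eqF.
- move=> t /andP[t0 ty].
  rewrite mulr_ge0//; last by rewrite ltW// f_gt0// t0 (le_trans (ltW ty)).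
  by rewrite mulrBr subr_ge0 e_mono// ltW.
Qed.

(* The elasticity of [F]. *)
Let k t := t * f t / F t.

Lemma elasticity_monotone t u : 0 < t -> t <= u -> u <= b -> s * k u <= s * k t.
Proof.
move=> t0 tu ub; rewrite -lerN2.
have xb x : t < x < u -> 0 < x <= b.
  by case/andP=> tx xu; rewrite (lt_trans t0 tx) (le_trans (ltW xu)).
apply: (@le_of_derive_ge0 _ (fun x => - (s * k x))
  (fun x => f x / F x ^+ 2 * (s * (x * f x - (1 + e x) * F x)))).
- exact: tu.
- apply: derivable_within_continuous => x; rewrite in_itv/= => /andP[tx xu].
  have x0 : 0 < x by rewrite (lt_le_trans t0).
  have xb' : 0 < x <= b by rewrite x0 (le_trans xu).
  have /derivableP dFx := @ex_derive _ _ _ _ _ _ _ (dF _ xb').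
  have /derivableP dfx := @ex_derive _ _ _ _ _ _ _ (df _ xb').
  apply: derivableN; apply: derivableM => //; apply: derivableM.
    exact: derivableM.
  by apply: derivableV => //; rewrite gt_eqF// primitive_gt0.
- move=> x /xb xb'.
  have x0 : 0 < x by case/andP: xb'.
  have Fx := primitive_gt0 _ xb'.
  have := dF _ xb'; have := df _ xb' => dfx dFx.
  have dFV : is_derive x 1 (fun y => (F y)^-1) (- (F x) ^- 2 * f x).
    by apply: is_derive_eq (is_deriveV _ _) _; rewrite ?gt_eqF.
  have -> : (fun x => - (s * k x)) =
    - (cst s * (id * f * (fun y => (F y)^-1))) by [].
  apply: is_derive_eq.
  rewrite /= /GRing.scale/= -[(id * f) x]/(x * f x); field.
  by rewrite !gt_eqF.
- move=> x /xb xb'; rewrite mulr_ge0 ?integrand_elasticity_bound//.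
  rewrite divr_ge0 ?sqr_ge0//.
  by rewrite ltW ?f_gt0.
Qed.

(** In logarithmic coordinates this is the tangent line at [x] to the graph of
[F], of slope [k x]: the quotient of [F] by [t ^ k x] has its extremum at [x]
because its logarithmic derivative is [(k t - k x) / t]. *)
Lemma power_bound x t : 0 < x <= b -> 0 < t <= b ->
  s * F t <= s * (F x * (t / x) `^ k x).
Proof.
move=> /andP[x0 xb] /andP[t0 tb].
pose h y := s * (F y * y `^ (- k x)).
pose h' y := y^-1 * y `^ (- k x) * F y * (s * k y - s * k x).
have dh y : 0 < y <= b -> is_derive y 1 h (h' y).
  move=> /[dup] yb /andP[y0 _].
  have dFy := dF _ yb.
  have dp := is_derive1_powR (- k x) y0.
  have -> : h = cst s * (F * (@powR R ^~ (- k x))) by [].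
  apply: is_derive_eq.
  have Fy := primitive_gt0 _ yb.
  rewrite /h' /= /GRing.scale/= powRB ?powRr1 ?(ltW y0)//; last first.
    by rewrite (gt_eqF y0) implybT.
  rewrite (_ : k y = y * f y / F y)//; field.
  by rewrite !gt_eqF.
have ch u v : 0 < u -> v <= b -> {within `[u, v], continuous h}.
  move=> u0 vb; apply: derivable_within_continuous => y.
  rewrite in_itv/= => /andP[uy yv].
  have yb : 0 < y <= b by rewrite (lt_le_trans u0) ?(le_trans yv).
  by have [] := dh _ yb.
suff hx : h t <= h x.
  have tk : t `^ (- k x) * t `^ k x = 1.
    by rewrite -powRD ?(gt_eqF t0) ?implybT// addNr powRr0.
  have -> : (t / x) `^ k x = x `^ (- k x) * t `^ k x.
    by rewrite powRM ?invr_ge0 ?ltW// mulrC -powR_inv1 ?ltW// -powRrM mulN1r.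
  have -> : s * F t = h t * t `^ k x by rewrite /h -!mulrA tk mulr1.
  by rewrite !mulrA -[s * F x * _]mulrA ler_wpM2r ?powR_ge0.
have [tx|xt] := leP t x.
  apply: (@le_of_derive_ge0 _ h h' _ _ tx (ch _ _ t0 xb)) => y /andP[ty yx].
    by apply: dh; rewrite (lt_trans t0) ?(le_trans (ltW yx)).
  have y0 := lt_trans t0 ty.
  have Fy : 0 < F y by rewrite primitive_gt0// y0 (le_trans (ltW yx)).
  rewrite /h' mulr_ge0 ?subr_ge0 ?elasticity_monotone ?(ltW yx)//.
  by rewrite !mulr_ge0 ?invr_ge0 ?powR_ge0 ?ltW.
rewrite -lerN2; have cN : {within `[x, t], continuous (fun y => - h y)}.
  by move=> y; apply: cvgN; exact: ch.
apply: (@le_of_derive_ge0 _ _ (fun y => - h' y) _ _ (ltW xt) cN).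
  move=> y /andP[xy yt]; apply: is_deriveN; apply: dh.
  by rewrite (lt_trans x0) ?(le_trans (ltW yt)).
move=> y /andP[xy yt].
have yb := le_trans (ltW yt) tb.
have y0 := lt_trans x0 xy.
have Fy : 0 < F y by rewrite primitive_gt0// y0.
rewrite /h' -mulrN mulr_ge0 ?oppr_ge0 ?subr_le0 ?elasticity_monotone ?(ltW xy)//.
by rewrite !mulr_ge0 ?invr_ge0 ?powR_ge0 ?ltW.
Qed.

Lemma geometric_mean_le x y l : 0 < x <= b -> 0 < y <= b -> 0 <= l <= 1 ->
  0 < x `^ l * y `^ (1 - l) <= b.
Proof.
move=> /andP[x0 xb] /andP[y0 yb] /andP[l0 l1].
have b0 := lt_le_trans x0 xb.
rewrite mulr_gt0 ?powR_gt0//=.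
rewrite -[leRHS](powR_mean _ _ l (ltW b0)).
by rewrite ler_pM ?powR_ge0// ge0_ler_powR ?subr_ge0 ?nnegrE
  ?(ltW x0) ?(ltW y0) ?(ltW b0).
Qed.

(** At the geometric mean [z] the two power bounds share the exponent [k z], and
their weighted product is exactly [F z] since
[(x / z) ^ l * (y / z) ^ (1 - l) = 1]. *)
Lemma primitive_geometric x y l : 0 < x <= b -> 0 < y <= b -> 0 <= l <= 1 ->
  s * (F x `^ l * F y `^ (1 - l)) <= s * F (x `^ l * y `^ (1 - l)).
Proof.
move=> xb yb /[dup] l01 /andP[l0 l1].
set z := x `^ l * _.
have zb : 0 < z <= b := geometric_mean_le _ _ _ xb yb l01.
have [x0 y0 z0] : [/\ 0 < x, 0 < y & 0 < z].
  by move/andP: (xb) => [? _]; move/andP: (yb) => [? _]; move/andP: (zb) => [? _].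
have [Fx Fy Fz] : [/\ 0 < F x, 0 < F y & 0 < F z] by split; exact: primitive_gt0.
have l1' : 0 <= 1 - l by rewrite subr_ge0.
have FzE : F z = (F z * (x / z) `^ k z) `^ l * (F z * (y / z) `^ k z) `^ (1 - l).
  have u0 : 0 <= x / z by rewrite divr_ge0 ?ltW.
  have v0 : 0 <= y / z by rewrite divr_ge0 ?ltW.
  have uv : (x / z) `^ l * (y / z) `^ (1 - l) = 1.
    have zV0 : 0 <= z^-1 by rewrite invr_ge0 ltW.
    rewrite powRM ?(ltW x0)// powRM ?(ltW y0)// mulrACA -/z.
    by rewrite powR_mean// divff// gt_eqF.
  rewrite powRM ?powR_ge0 ?(ltW Fz)// powRM ?powR_ge0 ?(ltW Fz)// mulrACA.
  rewrite powR_mean ?(ltW Fz)// (powRAC (x / z)) (powRAC (y / z)).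
  by rewrite -powRM ?powR_ge0// uv powR1 mulr1.
have Bx := power_bound _ _ zb xb; have By := power_bound _ _ zb yb.
have [s0|s0|s0] := ltgtP s 0; last by rewrite s0 !mul0r.
- rewrite ler_nM2l// in Bx; rewrite ler_nM2l// in By; rewrite ler_nM2l//.
  by rewrite [leLHS]FzE ler_pM ?powR_ge0// ge0_ler_powR ?nnegrE ?mulr_ge0
    ?powR_ge0 ?(ltW Fx) ?(ltW Fy) ?(ltW Fz).
- rewrite ler_pM2l// in Bx; rewrite ler_pM2l// in By; rewrite ler_pM2l//.
  by rewrite [leRHS]FzE ler_pM ?powR_ge0// ge0_ler_powR ?nnegrE ?mulr_ge0
    ?powR_ge0 ?(ltW Fx) ?(ltW Fy) ?(ltW Fz).
Qed.

End elasticity.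

(** * The integrals of [(1 + c * t ^ q) ^ a] *)

Definition binomial_power {R : realType} (a c q t : R) : R :=
  (1 + c * t `^ q) `^ a.

Definition binomial_integral {R : realType} (a c q x : R) : R :=
  \int[@lebesgue_measure R]_(t in `[0, x]) binomial_power a c q t.

(** When [q > 0], this is [(0, 1)] for [c = -1], and [(0, +oo)] for [c = 1]. *)
Definition binomial_domain {R : realType} (c q : R) : set R :=
  [set x | 0 < x /\ 0 < 1 + c * x `^ q].

Section binomial_integral.
Context {R : realType}.
Variables (a c q : R).
Hypothesis q0 : 0 < q.
Implicit Types t u b x y l : R.
Local Notation f := (binomial_power a c q).
Local Notation F := (binomial_integral a c q).
Local Notation D := (binomial_domain c q).
(* The elasticity of [f]. *)
Let e t := a * q * (c * t `^ q) / (1 + c * t `^ q).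

Lemma binomial_domainW b t : D b -> 0 < t <= b -> D t.
Proof.
move=> [b0 bb] /andP[t0 tb]; split=> //.
have [c0|c0] := leP 0 c; first by rewrite ltr_wpDr// mulr_ge0// powR_ge0.
rewrite (lt_le_trans bb)// lerD2l ler_nM2l// ge0_ler_powR ?nnegrE ?(ltW q0)//.
all: exact: ltW.
Qed.

Lemma is_derive_binomial_base t : 0 < t ->
  is_derive t 1 (fun x => 1 + c * x `^ q) (c * (q * t `^ q / t)).
Proof.
move=> t0; have dp := is_derive1_powR q t0.
have -> : (fun x => 1 + c * x `^ q) = cst 1 + c *: (@powR R ^~ q) by [].
apply: (is_derive_eq (is_deriveD (is_derive_cst _ _ _) (is_deriveZ _ dp))).
rewrite add0r /GRing.scale/= powRB ?powRr1 ?(ltW t0)//; last first.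
  by rewrite (gt_eqF t0) implybT.
by rewrite mulrA.
Qed.

Lemma open_binomial_domain t : D t -> \forall x \near t, D x.
Proof.
move=> [t0 bt]; have := is_derive_binomial_base _ t0 => dbt.
have ct : {for t, continuous (fun x => 1 + c * x `^ q)}.
  by apply/differentiable_continuous/derivable1_diffP; have [] := dbt.
near=> x; split; near: x; first exact: lt_nbhsr.
exact: (cvgr_gt _ ct).
Unshelve. all: by end_near. Qed.

Lemma is_derive_binomial_power t : D t -> is_derive t 1 f (e t / t * f t).
Proof.
move=> [t0 bt]; have db := is_derive_binomial_base _ t0.
have dp := is_derive1_powR a bt.
have -> : f = (@powR R ^~ a) \o (fun x => 1 + c * x `^ q) by [].
apply: is_derive_eq.
rewrite /= /GRing.scale/= powRB ?powRr1 ?(ltW bt)//; last first.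
  by rewrite (gt_eqF bt) implybT.
by rewrite /e /=; field; rewrite !gt_eqF.
Qed.

Lemma continuous_binomial_power t : D t -> {for t, continuous f}.
Proof.
move=> Dt; apply/differentiable_continuous/derivable1_diffP.
by have [] := is_derive_binomial_power _ Dt.
Qed.

(** At [0] only right continuity holds: real powers of negative numbers take the
default value [1]. *)
Lemma within_continuous_binomial_power b : D b ->
  {within `[0, b], continuous f}.
Proof.
move=> Db; have [b0 _] := Db.
apply/(continuous_within_itvP _ b0); split.
- move=> x; rewrite in_itv/= => /andP[x0 xb].
  apply: continuous_binomial_power; apply: binomial_domainW Db _.
  by rewrite x0 ltW.
- have -> : f 0 = (1 + c * 0) `^ a by rewrite /binomial_power powR0// gt_eqF.
  have cp : {for 1 + c * 0, continuous (@powR R ^~ a)}.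
    apply/differentiable_continuous/derivable1_diffP.
    have p0 : 0 < 1 + c * 0 :> R by rewrite mulr0 addr0.
    by have [] := is_derive1_powR a p0.
  apply: (cvg_comp (fun x => 1 + c * x `^ q) (@powR R ^~ a) _ cp).
  apply: cvgD; first exact: cvg_cst.
  by apply: cvgM; [exact: cvg_cst|exact: powR_cvg0].
- by apply/cvg_at_left_filter; exact: continuous_binomial_power.
Qed.

Lemma binomial_power_gt0 t : D t -> 0 < f t.
Proof. by case=> _ bt; rewrite powR_gt0. Qed.

Lemma integrable_binomial_power b : D b ->
  (@lebesgue_measure R).-integrable `[0, b] (EFin \o f).
Proof.
move=> Db; apply: continuous_compact_integrable; first exact: segment_compact.
exact: within_continuous_binomial_power.
Qed.

Lemma binomial_integral0 : F 0 = 0.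
Proof. by rewrite /binomial_integral set_itv1 Rintegral_set1. Qed.

Lemma within_continuous_binomial_integral b : D b ->
  {within `[0, b], continuous F}.
Proof.
move=> Db; apply: parameterized_integral_continuous.
  by case: Db => /ltW.
exact: integrable_binomial_power.
Qed.

(** The fundamental theorem of calculus needs integrability a little beyond
[t], which the openness of the domain provides. *)
Lemma is_derive_binomial_integral t : D t -> is_derive t 1 F (f t).
Proof.
move=> Dt; have [t0 _] := Dt.
near (t^'+) => u.
have tu : t < u by [].
have Du : D u.
  by near: u; apply: cvg_within; exact: open_binomial_domain.
have [dF FE] := continuous_FTC1_closed tu (integrable_binomial_power _ Du) t0
  (continuous_binomial_power _ Dt).
by apply: DeriveDef; [exact: dF|rewrite -derive1E; exact: FE].
Unshelve. all: by end_near. Qed.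

(** With [u = t ^ q], the left-hand side is [u / (1 + c * u)], which increases
with [u], times the constant [a * q * c ^ 2 <= 0]. *)
Lemma binomial_elasticity_monotone b : D b -> a <= 0 -> forall t u : R,
  0 < t -> t <= u -> u <= b -> c * e u <= c * e t.
Proof.
move=> Db a0 t u t0 tu ub.
have u0 := lt_le_trans t0 tu.
have [_ bt] : D t by apply: binomial_domainW Db _; rewrite t0 (le_trans tu).
have [_ bu] : D u by apply: binomial_domainW Db _; rewrite u0.
have tuq : t `^ q <= u `^ q.
  by rewrite ge0_ler_powR ?nnegrE ?(ltW q0) ?(ltW t0) ?(ltW u0).
rewrite -subr_ge0.
have -> : c * e t - c * e u = - a * (q * c ^+ 2 * (u `^ q - t `^ q)
    / ((1 + c * t `^ q) * (1 + c * u `^ q))).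
  by rewrite /e; field; rewrite !gt_eqF.
rewrite mulr_ge0 ?oppr_ge0// divr_ge0//; last by rewrite mulr_ge0 ?ltW.
by rewrite mulr_ge0 ?subr_ge0// mulr_ge0 ?sqr_ge0 ?ltW.
Qed.

Lemma binomial_integral_lt x y : 0 <= x -> x < y -> D y -> F x < F y.
Proof.
move=> x0 xy Dy.
apply: (@primitive_lt R y F f) => //.
- exact: within_continuous_binomial_integral.
- by move=> t tb; apply: is_derive_binomial_integral; exact: binomial_domainW tb.
- by move=> t tb; apply: binomial_power_gt0; exact: binomial_domainW tb.
Qed.

Lemma binomial_domain_mean x y l : D x -> D y -> 0 <= l <= 1 ->
  D (x `^ l * y `^ (1 - l)).
Proof.
move=> Dx Dy l01; have [x0 _] := Dx; have [y0 _] := Dy.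
have Dm : D (Num.max x y) by case: leP.
apply: binomial_domainW Dm _; apply: geometric_mean_le => //.
  by rewrite x0 le_max lexx.
by rewrite y0 le_max lexx orbT.
Qed.

Lemma binomial_integral_geometric x y l : a <= 0 -> D x -> D y ->
  0 <= l <= 1 ->
  c * (F x `^ l * F y `^ (1 - l)) <= c * F (x `^ l * y `^ (1 - l)).
Proof.
move=> a0 Dx Dy l01; have [x0 _] := Dx; have [y0 _] := Dy.
have Dm : D (Num.max x y) by case: leP.
apply: (@primitive_geometric R c (Num.max x y) F f e) => //.
- exact: within_continuous_binomial_integral.
- exact: binomial_integral0.
- by move=> t tb; apply: is_derive_binomial_integral; exact: binomial_domainW tb.
- exact: within_continuous_binomial_power.
- by move=> t tb; apply: binomial_power_gt0; exact: binomial_domainW tb.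
- by move=> t tb; apply: is_derive_binomial_power; exact: binomial_domainW tb.
- exact: binomial_elasticity_monotone.
- by rewrite x0 le_max lexx.
- by rewrite y0 le_max lexx orbT.
Qed.

Lemma binomial_integral_surj b y : D b -> 0 < y -> y <= F b ->
  exists2 x, D x & F x = y.
Proof.
move=> Db y0 yb; have [b0 _] := Db.
have [||x xb Fx] := @IVT R F 0 b y (ltW b0).
- exact: within_continuous_binomial_integral.
- rewrite binomial_integral0 minEle maxEle (ltW (lt_le_trans y0 yb)).
  by rewrite (ltW y0) yb.
exists x => //; apply: binomial_domainW Db _.
move: xb; rewrite in_itv/= => /andP[x0 ->]; rewrite andbT lt_neqAle x0 andbT.
by apply/eqP => x0'; move: y0; rewrite -Fx -x0' binomial_integral0 ltxx.
Qed.

End binomial_integral.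

(** * Inverses of these integrals on the unit interval *)

Section inverse.
Context {R : realType}.
Variables (a c q : R) (g : R -> R).
Hypothesis q0 : 0 < q.
Hypothesis a0 : a <= 0.
Local Notation F := (binomial_integral a c q).
Local Notation D := (binomial_domain c q).
Hypothesis gD : forall y, 0 < y < 1 -> D (g y).
Hypothesis gK : forall y, 0 < y < 1 -> F (g y) = y.
Implicit Types x y l : R.

Lemma binomial_integral_le_mono x y : D x -> D y -> (F x <= F y) = (x <= y).
Proof.
move=> Dx Dy; have [x0 _] := Dx; have [y0 _] := Dy.
have [xy|yx|->] := ltgtP x y; last by rewrite lexx.
- by rewrite ltW// binomial_integral_lt// ltW.
- by apply/negbTE; rewrite -ltNge binomial_integral_lt// ltW.
Qed.

Lemma continuous_inverse y : 0 < y < 1 -> {for y, continuous g}.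
Proof.
move=> y01; have Dg := gD _ y01.
have cF x : D x -> {for x, continuous F}.
  move=> Dx; apply/differentiable_continuous/derivable1_diffP.
  by have [] := is_derive_binomial_integral a _ _ q0 _ Dx.
suff : {near F (g y), continuous g} by rewrite gK// => /nbhs_singleton.
apply: near_can_continuous; near=> x.
- have Dx : D x by near: x; exact: open_binomial_domain.
  have Fx01 : 0 < F x < 1.
    suff : F x \in `]0, 1[ by rewrite in_itv.
    near: x; apply: (cF _ Dg (fun z => z \in `]0, 1[)).
    by rewrite gK//; apply: near_in_itvoo; rewrite in_itv.
  have DgF := gD _ Fx01.
  apply/eqP; rewrite eq_le -(binomial_integral_le_mono _ _ DgF Dx).
  by rewrite -(binomial_integral_le_mono _ _ Dx DgF) gK// lexx.
- by apply: cF; near: x; exact: open_binomial_domain.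
Unshelve. all: by end_near. Qed.

Lemma continuous_positive_inverse : continuous_positive_on `]0, 1[ g.
Proof.
split.
- exact: interval_is_interval.
- by move=> x /=; rewrite !in_itv/= => /andP[-> _].
- apply: continuous_in_subspaceT => y /[1!inE] /=; rewrite in_itv/=.
  exact: continuous_inverse.
- by move=> y /=; rewrite in_itv/= => /gD[].
Qed.

Lemma inverse_geometric x y l : 0 < x < 1 -> 0 < y < 1 -> 0 <= l <= 1 ->
  c * g (x `^ l * y `^ (1 - l)) <= c * (g x `^ l * g y `^ (1 - l)).
Proof.
move=> x01 y01 l01.
have m01 : 0 < x `^ l * y `^ (1 - l) < 1.
  have [[x0 x1] [y0 y1]] := (andP x01, andP y01).
  have : 0 < x `^ l * y `^ (1 - l) <= Num.max x y.
    by apply: geometric_mean_le => //; rewrite ?x0 ?y0 le_max lexx ?orbT.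
  by move=> /andP[-> /le_lt_trans]; apply; rewrite gt_max x1.
have := binomial_integral_geometric _ _ _ q0 _ _ _ a0 (gD _ x01) (gD _ y01) l01.
rewrite !gK// -{1}(gK _ m01).
have Dm := binomial_domain_mean _ _ q0 _ _ _ (gD _ x01) (gD _ y01) l01.
have [c0|c0|c0] := ltgtP c 0; last by rewrite c0 !mul0r.
- by rewrite !ler_nM2l// binomial_integral_le_mono//; exact: gD.
- by rewrite !ler_pM2l// binomial_integral_le_mono//; exact: gD.
Qed.

End inverse.

(** * The generalized sine and hyperbolic sine *)

Section trigonometric.
Context {R : realType}.
Variables (p q : R).
Hypothesis p1 : 1 < p.
Hypothesis q1 : 1 < q.
Implicit Types t x y : R.

Let p0 : 0 < p. Proof. exact: lt_trans p1. Qed.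
Let q0 : 0 < q. Proof. exact: lt_trans q1. Qed.

Lemma arcsin_pqE x : arcsin_pq p q x = binomial_integral (- p^-1) (-1) q x.
Proof.
by apply: eq_Rintegral => t _; rewrite /binomial_power mulN1r.
Qed.

Lemma arcsinh_pqE x : arcsinh_pq p q x = binomial_integral (- p^-1) 1 q x.
Proof. by apply: eq_Rintegral => t _; rewrite /binomial_power mul1r. Qed.

Lemma binomial_domainN1 x : binomial_domain (-1) q x <-> 0 < x < 1.
Proof.
rewrite /binomial_domain/= mulN1r subr_gt0; split.
- case=> x0 xq1; rewrite x0 ltNge; apply/negP => x1.
  by move: xq1; rewrite powR_lt1 ?(ltW x0)// ltNge x1.
- by case/andP=> x0 x1; rewrite powR_lt1 ?(ltW x0).
Qed.

Lemma binomial_domain1 x : binomial_domain 1 q x <-> 0 < x.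
Proof.
split=> [[]//|x0]; split=> //.
by rewrite mul1r ltr_wpDr// powR_ge0.
Qed.

Lemma le_arcsin_pq x : 0 < x < 1 -> x <= arcsin_pq p q x.
Proof.
move=> x01; rewrite arcsin_pqE -subr_ge0.
have Dx : binomial_domain (-1) q x by apply/binomial_domainN1.
have [x0 x1] := andP x01.
set F := binomial_integral _ _ _.
have -> : 0 = F 0 - 0 :> R by rewrite /F binomial_integral0 subr0.
apply: (@le_of_derive_ge0 _ (fun t => F t - t)
  (fun t => binomial_power (- p^-1) (-1) q t - 1)).
- exact: ltW.
- move=> t; apply: cvgB; first exact: within_continuous_binomial_integral.
  exact: (continuous_subspaceT (fun x => cvg_id)).
- move=> t /andP[t0 tx].
  have Dt : binomial_domain (-1) q t.
    by apply/binomial_domainN1; rewrite t0 (lt_trans tx).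
  have dF := is_derive_binomial_integral (- p^-1) _ _ q0 _ Dt.
  exact: is_deriveB.
- move=> t /andP[t0 tx].
  have [_] : binomial_domain (-1) q t.
    by apply/binomial_domainN1; rewrite t0 (lt_trans tx).
  rewrite subr_ge0 /binomial_power mulN1r => bt.
  rewrite -[leLHS](powRr0 (1 - t `^ q)) ger_powR ?bt ?gerBl ?powR_ge0//.
  by rewrite oppr_le0 invr_ge0 ltW.
Qed.

(** A divergent integral would have the real value [0], so positivity makes the
integral over [[0, 1]] finite, without an estimate near the singularity. *)
Lemma arcsin_pq_lt1 x : 0 < x < 1 -> 0 < arcsin_pq p q 1 ->
  arcsin_pq p q x < arcsin_pq p q 1.
Proof.
move=> /andP[x0 x1] F1.
pose z := (x + 1) / 2.
have [xz z1] : x < z /\ z < 1 by rewrite /z; split; lra.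
have z0 := lt_trans x0 xz.
have Dz : binomial_domain (-1) q z by apply/binomial_domainN1; rewrite z0.
apply: (@lt_le_trans _ _ (arcsin_pq p q z)).
  by rewrite !arcsin_pqE binomial_integral_lt// ltW.
move: F1; rewrite !arcsin_pqE /binomial_integral /Rintegral.
set f := binomial_power _ _ _.
set I1 := (\int[@lebesgue_measure R]_(t in `[0%R, 1%R]) (f t)%:E)%E.
set Iz := (\int[@lebesgue_measure R]_(t in `[0%R, z]) (f t)%:E)%E => I1_gt0.
have Iz_fin : Iz \is a fin_num.
  by apply: integrable_fin_num => //; exact: integrable_binomial_power.
have I1_fin : I1 \is a fin_num by case: I1 I1_gt0 => //=; rewrite ltxx.
apply: fine_le => //; apply: ge0_subset_integral => //=.
- apply/measurable_EFinP; apply: measurable_funTS.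
  apply: (measurableT_comp (@measurable_powR R _)).
  apply: measurable_funD; first exact: measurable_cst.
  apply: measurable_funM; first exact: measurable_cst.
  exact: measurable_powR.
- by move=> t _; rewrite lee_fin powR_ge0.
- by move=> t /=; rewrite !in_itv/= => /andP[-> /le_trans->//]; exact: ltW.
Qed.

Lemma sin_pqP y : 0 < y < 1 ->
  0 < sin_pq p q y < 1 /\ arcsin_pq p q (sin_pq p q y) = y.
Proof.
move=> /[dup] y01 /andP[y0 y1].
have Dy : binomial_domain (-1) q y by apply/binomial_domainN1.
have [x Dx Fx] : exists2 x, binomial_domain (-1) q x &
    binomial_integral (- p^-1) (-1) q x = y.
  by apply: binomial_integral_surj Dy y0 _; rewrite // -arcsin_pqE le_arcsin_pq.
have x01 : 0 < x < 1 by apply/binomial_domainN1.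
rewrite -arcsin_pqE in Fx.
have yim : (arcsin_pq p q @` `[0, 1]) y.
  by exists x => //=; rewrite in_itv/=; case/andP: x01 => /ltW-> /ltW->.
have sK : arcsin_pq p q (sin_pq p q y) = y by apply: pinvK; rewrite inE.
split=> //.
have : `[0, 1]%classic (sin_pq p q y).
  have imA := @subset_refl _ (arcsin_pq p q @` `[0, 1]).
  by apply: (surjpinv_image_sub imA); exists y.
rewrite /= in_itv/= => /andP[s0 s1].
rewrite !lt_neqAle s0 s1 !andbT eq_sym; apply/andP; split; apply/eqP => sE.
  by move: y0; rewrite -sK sE arcsin_pqE binomial_integral0 ltxx.
rewrite sE in sK.
by have := arcsin_pq_lt1 _ x01; rewrite Fx sK => /(_ y0); rewrite ltxx.
Qed.

(** The left-hand side has derivative [(1 + x ^ q) ^ (- 1 / q - 1)], which is at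
most [(1 + x ^ q) ^ (- 1)], hence at most the integrand. *)
Lemma le_arcsinh_pq x : 0 < x ->
  x * (1 + x `^ q) `^ (- q^-1) <= arcsinh_pq p q x.
Proof.
move=> x0; rewrite arcsinh_pqE -subr_ge0.
have Dp t : 0 < t -> binomial_domain 1 q t by move=> ?; apply/binomial_domain1.
set F := binomial_integral _ _ _.
pose h := binomial_power (- q^-1) 1 q.
have -> : (1 + x `^ q) `^ (- q^-1) = h x by rewrite /h /binomial_power mul1r.
have -> : 0 = F 0 - 0 * h 0 :> R by rewrite /F binomial_integral0 mul0r subr0.
apply: (@le_of_derive_ge0 _ (fun t => F t - t * h t)
  (fun t => binomial_power (- p^-1) 1 q t - h t / (1 + t `^ q))).
- exact: ltW.
- move=> t; apply: cvgB.
    by apply: within_continuous_binomial_integral => //; exact: Dp.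
  apply: cvgM; first exact: (continuous_subspaceT (fun x => cvg_id)).
  by apply: within_continuous_binomial_power => //; exact: Dp.
- move=> t /andP[t0 tx].
  have dF := is_derive_binomial_integral (- p^-1) _ _ q0 _ (Dp _ t0).
  have dh := is_derive_binomial_power (- q^-1) _ _ _ (Dp _ t0).
  have [_ bt] := Dp _ t0; rewrite mul1r in bt.
  have -> : (fun t => F t - t * h t) = F - id * h by [].
  apply: is_derive_eq.
  rewrite /= /GRing.scale/= -/h; field.
  by rewrite !gt_eqF// mul1r.
- move=> t /andP[t0 tx].
  have [_] := Dp _ t0.
  rewrite subr_ge0 /h /binomial_power mul1r => bt.
  have b1 : 1 <= 1 + t `^ q by rewrite lerDl powR_ge0.
  have qV : 0 <= q^-1 by rewrite invr_ge0 ltW.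
  apply: (@le_trans _ _ (1 + t `^ q)^-1).
    rewrite ler_piMl ?invr_ge0 ?(ltW bt)//.
    by rewrite -[leRHS](powRr0 (1 + t `^ q)) ler_powR// oppr_le0.
  rewrite -powR_inv1 ?(ltW bt)// ler_powR// lerN2 invf_le1//.
  exact: ltW.
Qed.

Lemma sinh_pqP y : 0 < y < 1 ->
  0 < sinh_pq p q y /\ arcsinh_pq p q (sinh_pq p q y) = y.
Proof.
move=> /[dup] y01 /andP[y0 y1].
have [yq0 yq1] : 0 < y `^ q /\ 0 < 1 - y `^ q.
  by rewrite powR_gt0// subr_gt0 powR_lt1 ?(ltW y0).
(* The solution of [b * (1 + b ^ q) ^ (- 1 / q) = y]. *)
pose b := y * (1 - y `^ q) `^ (- q^-1).
have b0 : 0 < b by rewrite mulr_gt0// powR_gt0.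
have bq : 1 + b `^ q = (1 - y `^ q)^-1.
  rewrite /b powRM ?powR_ge0 ?(ltW y0)// -powRrM mulNr mulVf ?gt_eqF//.
  rewrite powR_inv1 ?(ltW yq1)//; field.
  by rewrite gt_eqF.
have Db : binomial_domain 1 q b by apply/binomial_domain1.
have [x Dx Fx] : exists2 x, binomial_domain 1 q x &
    binomial_integral (- p^-1) 1 q x = y.
  apply: binomial_integral_surj Db y0 _; rewrite // -arcsinh_pqE.
  rewrite (le_trans _ (le_arcsinh_pq _ b0))// bq /b.
  rewrite -mulrA -(powR_inv1 (ltW yq1)) -powRrM mulN1r opprK.
  rewrite -powRD ?(gt_eqF yq1) ?implybT// addNr powRr0 mulr1.
  exact: lexx.
rewrite -arcsinh_pqE in Fx.
have yim : (arcsinh_pq p q @` `]0, +oo[) y.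
  by exists x => //=; rewrite in_itv/= andbT; case: Dx.
split; last by apply: pinvK; rewrite inE.
have : `]0, +oo[%classic (sinh_pq p q y).
  have imA := @subset_refl _ (arcsinh_pq p q @` `]0, +oo[).
  by apply: (surjpinv_image_sub imA); exists y.
by rewrite /= in_itv/= andbT.
Qed.

End trigonometric.

Theorem theorem1p1 (R : realType) (p q : R) (hp : 1 < p) (hq : 1 < q) :
  geometrically_concave `]0, 1[ (sin_pq p q) /\
  geometrically_convex `]0, 1[ (sinh_pq p q).
Proof.
have q0 : 0 < q by exact: lt_trans hq.
have a0 : - p^-1 <= 0 by rewrite oppr_le0 invr_ge0 ltW// (lt_trans _ hp).
have sD y : 0 < y < 1 -> binomial_domain (-1) q (sin_pq p q y).
  by move=> /(sin_pqP _ _ hp hq)[s01 _]; apply/binomial_domainN1.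
have sK y : 0 < y < 1 ->
    binomial_integral (- p^-1) (-1) q (sin_pq p q y) = y.
  by move=> /(sin_pqP _ _ hp hq)[_]; rewrite arcsin_pqE.
have shD y : 0 < y < 1 -> binomial_domain 1 q (sinh_pq p q y).
  by move=> /(sinh_pqP _ _ hp hq)[s0 _]; apply/binomial_domain1.
have shK y : 0 < y < 1 ->
    binomial_integral (- p^-1) 1 q (sinh_pq p q y) = y.
  by move=> /(sinh_pqP _ _ hp hq)[_]; rewrite arcsinh_pqE.
split; split.
- exact: (continuous_positive_inverse _ _ _ _ q0 sD sK).
- move=> x y l /=; rewrite !in_itv/= => x01 y01 l01.
  have := inverse_geometric _ _ _ _ q0 a0 sD sK _ _ _ x01 y01 l01.
  by rewrite !mulN1r lerN2.
- exact: (continuous_positive_inverse _ _ _ _ q0 shD shK).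
- move=> x y l /=; rewrite !in_itv/= => x01 y01 l01.
  have := inverse_geometric _ _ _ _ q0 a0 shD shK _ _ _ x01 y01 l01.
  by rewrite !mul1r.
Qed.
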